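(* Let $F=\frac1n\sum_{i=1}^n f_i:\mathbb{R}^d\to\mathbb{R}$, where $F$ is differentiable and $\mu$-strongly convex ($\mu>0$), and each $f_i:\mathbb{R}^d\to\mathbb{R}$ is differentiable, convex and $L$-smooth. Let $x^*$ be the unique minimizer of $F$. Let $(x_k,(g_k^i)_{i=1}^n)_{k\ge 0}$ be generated by the SRG algorithm with a constant lower bound $\varepsilon_k=\varepsilon\in(0,\frac{1}{2n}]$ and a constant step size $\alpha_k=\alpha$ with $0<\alpha\le\frac{n\varepsilon}{20L}$. Define, with $a=0.673$, $$T^k:=\frac{\alpha}{n\varepsilon}\frac{a}{L}\sum_{i=1}^n\|g_k^i-\nabla f_i(x^* )\|_2^2+\|x_k-x^*\|_2^2 .$$ Then for any $k\in\mathbb{N}$, $$\mathbb{E}[T^k]\le(1-\alpha\zeta)^kT^0+(1+2n\varepsilon)\frac{2\alpha\sigma_*^2}{\zeta},$$ where $\zeta:=\min\{L/n,\mu\}$ and $\sigma_*^2:=\frac{1}{n^2}\left(\sum_{i=1}^n\|\nabla f_i(x^* )\|_2\right)^2$.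
   Context: $\mathbb{N}=\{0,1,2,\dots\}$ and $[n]=\{1,\dots,n\}$. $\mu$-strongly convex: $F(y)\ge F(x)+\langle\nabla F(x),y-x\rangle+\frac{\mu}{2}\|y-x\|_2^2$ for all $x,y$. $L$-smooth ($L>0$): $\|\nabla f_i(y)-\nabla f_i(x)\|_2\le L\|y-x\|_2$ for all $x,y$. Let $\Delta$ be the probability simplex in $\mathbb{R}^n$ and, for $\varepsilon\in(0,1/n]$, $\Delta(\varepsilon)=\{p\in\Delta: p^i\ge\varepsilon\ \forall i\in[n]\}$. SRG algorithm: parameters are deterministic step sizes $\alpha_k>0$ and lower bounds $\varepsilon_k\in(0,1/n]$; the initialization is a deterministic $x_0\in\mathbb{R}^d$ and $g_0^1,\dots,g_0^n\in\mathbb{R}^d$. For $k=0,1,2,\dots$: 1. $p_k\in\arg\min_{p\in\Delta(\varepsilon_k)}\frac{1}{n^2}\sum_{i=1}^n\frac{1}{p^i}\|g_k^i\|_2^2$ (if the minimizer is not unique, any one, chosen as a function of the history $(i_t,b_t)_{t<k}$); 2. sample $i_k\in[n]$ from $p_k$ (conditionally on the history); 3. $x_{k+1}=x_k-\alpha_k\frac{1}{np_k^{i_k}}\nabla f_{i_k}(x_k)$; 4. sample $b_k\sim\mathrm{Bernoulli}(\varepsilon_k/p_k^{i_k})$ (conditionally on the history and $i_k$); 5. $g_{k+1}^i=\nabla f_i(x_k)$ if $i=i_k$ and $b_k=1$; $g_{k+1}^i=g_k^i$ otherwise. *)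

(* Defs.v *)
From HB Require Import structures.
From mathcomp Require Import all_boot all_order all_algebra.
From mathcomp Require Import all_classical all_reals all_analysis.

Set Implicit Arguments.
Unset Strict Implicit.
Unset Printing Implicit Defensive.

Import Order.TTheory GRing.Theory Num.Theory.
Import numFieldNormedType.Exports.

Local Open Scope classical_set_scope.
Local Open Scope ring_scope.

Definition dotv (R : realType) (d : nat) (x y : 'rV[R]_d) : R :=
  \sum_(j < d) x 0 j * y 0 j.

(* The canonical norm `|x| on 'rV[R]_d is the sup norm, hence this definition. *)
Definition norm2 (R : realType) (d : nat) (x : 'rV[R]_d) : R :=
  Num.sqrt (dotv x x).

Definition gradient (R : realType) (d : nat) (f : 'rV[R]_d -> R)
    (x : 'rV[R]_d) : 'rV[R]_d :=
  \row_j 'D_(delta_mx 0 j) f x.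

Definition strongly_convex (R : realType) (d : nat) (mu : R)
    (F : 'rV[R]_d -> R) : Prop :=
  forall x y : 'rV[R]_d,
    F x + dotv (gradient F x) (y - x) + mu / 2 * norm2 (y - x) ^+ 2 <= F y.

Definition smooth (R : realType) (d : nat) (L : R)
    (f : 'rV[R]_d -> R) : Prop :=
  forall x y : 'rV[R]_d,
    norm2 (gradient f y - gradient f x) <= L * norm2 (y - x).

Definition minimizer_on (R : realType) (V : Type) (A : set V) (phi : V -> R)
    (x : V) : Prop :=
  A x /\ forall y, A y -> phi x <= phi y.

Definition average (R : realType) (d n : nat) (f : 'I_n -> 'rV[R]_d -> R) :
    'rV[R]_d -> R :=
  fun x => n%:R^-1 * \sum_(i < n) f i x.

Definition simplex (R : realType) (n : nat) : set 'rV[R]_n :=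
  [set p | (forall i, 0 <= p 0 i) /\ \sum_(i < n) p 0 i = 1].

Definition simplex_lb (R : realType) (n : nat) (eps : R) : set 'rV[R]_n :=
  [set p | simplex p /\ forall i, eps <= p 0 i].

Definition sampling_objective (R : realType) (d n : nat)
    (g : 'I_n -> 'rV[R]_d) (p : 'rV[R]_n) : R :=
  1 / n%:R ^+ 2 * \sum_(i < n) 1 / p 0 i * norm2 (g i) ^+ 2.

(* Elementary conditional probability P(A | B); meaningful when P B != 0. *)
Definition cond_prob (disp : measure_display) (T : measurableType disp)
    (R : realType) (P : probability T R) (A B : set T) : R :=
  fine (P (A `&` B)) / fine (P B).

Section SRG.
Context (disp : measure_display) (T : measurableType disp) (R : realType)
  (P : probability T R) (d n : nat).

Definition history (idx : nat -> T -> 'I_n) (b : nat -> T -> bool) (k : nat)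
    (w : T) : seq ('I_n * bool) :=
  mkseq (fun t => (idx t w, b t w)) k.

(* The processes x, g, p, idx, b on the probability space (T, P) form a run of
   the SRG algorithm for f_1, ..., f_n. The history takes finitely many values,
   so conditioning on it means conditioning on the atom of w, i.e. on the event
   that the history agrees with the one observed at w. *)
Record SRG_run (f : 'I_n -> 'rV[R]_d -> R) (alpha eps : nat -> R)
    (x0 : 'rV[R]_d) (g0 : 'I_n -> 'rV[R]_d)
    (x : nat -> T -> 'rV[R]_d) (g : nat -> T -> 'I_n -> 'rV[R]_d)
    (p : nat -> T -> 'rV[R]_n)
    (idx : nat -> T -> 'I_n) (b : nat -> T -> bool) : Prop := {
  SRG_alpha : forall k, 0 < alpha k;
  SRG_eps : forall k, 0 < eps k <= n%:R^-1;
  SRG_x0 : forall w, x 0%N w = x0;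
  SRG_g0 : forall w i, g 0%N w i = g0 i;
  SRG_p_min : forall k w,
    minimizer_on (simplex_lb (eps k)) (sampling_objective (g k w)) (p k w);
  SRG_p_history : forall k w w',
    history idx b k w = history idx b k w' -> p k w = p k w';
  SRG_idx_measurable : forall k i, measurable [set w | idx k w = i];
  SRG_idx_law : forall k w i,
    let H := [set w' | history idx b k w' = history idx b k w] in
    P H != 0%E ->
    cond_prob P [set w' | idx k w' = i] H = p k w 0 i;
  SRG_x_step : forall k w,
    x k.+1 w = x k w - (alpha k * (1 / (n%:R * p k w 0 (idx k w)))) *:
                         gradient (f (idx k w)) (x k w);
  SRG_b_measurable : forall k, measurable [set w | b k w = true];
  SRG_b_law : forall k w,
    let H := [set w' | history idx b k w' = history idx b k w /\
                       idx k w' = idx k w] in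
    P H != 0%E ->
    cond_prob P [set w' | b k w' = true] H = eps k / p k w 0 (idx k w);
  SRG_g_step : forall k w i,
    g k.+1 w i = if (i == idx k w) && b k w then gradient (f i) (x k w)
                 else g k w i
}.

End SRG.

Definition lyapunov (R : realType) (d n : nat) (f : 'I_n -> 'rV[R]_d -> R)
    (L alpha eps a : R) (xs : 'rV[R]_d) (g : 'I_n -> 'rV[R]_d)
    (x : 'rV[R]_d) : R :=
  alpha / (n%:R * eps) * (a / L) *
    \sum_(i < n) norm2 (g i - gradient (f i) xs) ^+ 2
  + norm2 (x - xs) ^+ 2.

Definition sigma2_star (R : realType) (d n : nat)
    (f : 'I_n -> 'rV[R]_d -> R) (xs : 'rV[R]_d) : R :=
  1 / n%:R ^+ 2 * (\sum_(i < n) norm2 (gradient (f i) xs)) ^+ 2.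

(* Main.v *)
Require Import Defs.
From HB Require Import structures.
From mathcomp Require Import all_boot all_order all_algebra.
From mathcomp Require Import all_classical all_reals all_analysis.
From mathcomp Require Import measurable_realfun ring lra.

Import Order.TTheory GRing.Theory Num.Theory.
Import numFieldNormedType.Exports.

Local Open Scope classical_set_scope.
Local Open Scope ring_scope.

(** It suffices to prove the one-step inequality
    [E[T^(k+1) | history] <=
     (1 - alpha zeta) T^k + (1 + 2 n eps) 2 alpha^2 sigma_star^2]
    and to sum the geometric series. Let [D] and [G] be the sums over [i] of
    [|grad f_i(x_k) - grad f_i(xs)|^2] and of [|g_k^i - grad f_i(xs)|^2]. Each
    [g^i] is refreshed with conditional probability [p^i (eps / p^i) = eps], so
    [G] becomes [(1 - eps) G + eps D] in mean. Strong convexity and cocoercivity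
    give [2 <grad F(x_k), x_k - xs> >= mu |x_k - xs|^2 + D / (n L)]. The second
    moment of the gradient estimate is split along
    [grad f_i(x_k) = (grad f_i(x_k) - grad f_i(xs)) - (g^i - grad f_i(xs)) + g^i],
    and the last part is controlled by the optimality of [p_k], compared with the
    mixture of the uniform law and the law proportional to [|g^i|]. *)

(** * Inner product and Euclidean norm on row vectors *)

Section euclidean.
Context {R : realType} {d : nat}.
Implicit Types (u v w : 'rV[R]_d) (c : R).

Lemma dotvC u v : dotv u v = dotv v u.
Proof. by apply: eq_bigr => j _; rewrite mulrC. Qed.

Lemma dotvDl u v w : dotv (u + v) w = dotv u w + dotv v w.
Proof. by rewrite -big_split; apply: eq_bigr => j _; rewrite mxE mulrDl. Qed.

Lemma dotvZl c u v : dotv (c *: u) v = c * dotv u v.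
Proof. by rewrite /dotv mulr_sumr; apply: eq_bigr => j _; rewrite mxE mulrA. Qed.

Lemma dotvNl u v : dotv (- u) v = - dotv u v.
Proof. by rewrite -scaleN1r dotvZl mulN1r. Qed.

Lemma dotvDr u v w : dotv u (v + w) = dotv u v + dotv u w.
Proof. by rewrite dotvC dotvDl !(dotvC u). Qed.

Lemma dotvZr c u v : dotv u (c *: v) = c * dotv u v.
Proof. by rewrite dotvC dotvZl dotvC. Qed.

Lemma dotvNr u v : dotv u (- v) = - dotv u v.
Proof. by rewrite dotvC dotvNl dotvC. Qed.

Lemma dotv0l u : dotv 0 u = 0.
Proof. by rewrite -(scale0r (0 : 'rV[R]_d)) dotvZl mul0r. Qed.

Lemma dotv_suml (I : Type) (r : seq I) (F : I -> 'rV[R]_d) v :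
  dotv (\sum_(i <- r) F i) v = \sum_(i <- r) dotv (F i) v.
Proof.
by elim/big_rec2 : _ => [|i y1 y2 _ <-]; [rewrite dotv0l|rewrite dotvDl].
Qed.

Lemma dotvv_ge0 u : 0 <= dotv u u.
Proof. by apply: sumr_ge0 => j _; rewrite -expr2 sqr_ge0. Qed.

Lemma norm2_ge0 u : 0 <= norm2 u.
Proof. exact: sqrtr_ge0. Qed.

Lemma sqr_norm2 u : norm2 u ^+ 2 = dotv u u.
Proof. by rewrite sqr_sqrtr// dotvv_ge0. Qed.

Lemma norm2N u : norm2 (- u) = norm2 u.
Proof. by rewrite /norm2 dotvNl dotvNr opprK. Qed.

Lemma norm2Z c u : 0 <= c -> norm2 (c *: u) = c * norm2 u.
Proof.
move=> c0; rewrite /norm2 dotvZl dotvZr mulrA -expr2 sqrtrM ?sqr_ge0//.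
by rewrite sqrtr_sqr ger0_norm.
Qed.

Lemma dotvv_eq0 u : dotv u u = 0 -> u = 0.
Proof.
move=> u0; apply/rowP => j; rewrite mxE.
have /allP/(_ j) : all (fun j => true ==> (u 0 j * u 0 j == 0)) (index_enum 'I_d).
  rewrite -psumr_eq0 => [|i _]; first exact/eqP.
  by rewrite -expr2 sqr_ge0.
by rewrite mem_index_enum/= mulf_eq0 orbb => /(_ isT)/eqP.
Qed.

(** Cauchy-Schwarz: the squared norm of [norm2 v *: u - norm2 u *: v] is nonnegative and equals
    2|u||v| (|u||v| - <u, v>). Vectors of norm zero come first, since the factor |u||v| has to be
    cancelled. *)
Lemma dotv_le_norm2 u v : dotv u v <= norm2 u * norm2 v.
Proof.
have [/eqP|u0] := eqVneq (norm2 u) 0.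
  rewrite sqrtr_eq0 => uu0.
  have -> : u = 0 by apply: dotvv_eq0; apply/eqP; rewrite eq_le uu0 dotvv_ge0.
  by rewrite dotv0l mulr_ge0 ?norm2_ge0.
have [/eqP|v0] := eqVneq (norm2 v) 0.
  rewrite sqrtr_eq0 => vv0.
  have -> : v = 0 by apply: dotvv_eq0; apply/eqP; rewrite eq_le vv0 dotvv_ge0.
  by rewrite dotvC dotv0l mulr_ge0 ?norm2_ge0.
have u_gt0 : 0 < norm2 u by rewrite lt_neqAle eq_sym u0 norm2_ge0.
have v_gt0 : 0 < norm2 v by rewrite lt_neqAle eq_sym v0 norm2_ge0.
have := dotvv_ge0 (norm2 v *: u - norm2 u *: v).
rewrite !(dotvDl, dotvDr, dotvNl, dotvNr, dotvZl, dotvZr) -!sqr_norm2 (dotvC v u).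
move=> H; rewrite -(ler_pM2l (mulr_gt0 u_gt0 v_gt0)) -subr_ge0.
lra.
Qed.

Lemma norm2D u v : norm2 (u + v) <= norm2 u + norm2 v.
Proof.
rewrite -ler_sqr ?nnegrE ?addr_ge0 ?norm2_ge0// sqr_norm2.
rewrite !(dotvDl, dotvDr) (dotvC v u) -!sqr_norm2.
have := dotv_le_norm2 u v.
lra.
Qed.

(* The weights satisfy 1/6 + 1/6 + 2/3 = 1. *)
Lemma sqr_norm2_three u v w :
  norm2 (u - v + w) ^+ 2 <=
  6 * norm2 u ^+ 2 + 6 * norm2 v ^+ 2 + 3 / 2 * norm2 w ^+ 2.
Proof.
rewrite !sqr_norm2 /dotv !mulr_sumr -!big_split /=; apply: ler_sum => j _.
rewrite !mxE; set a := u 0 j; set b := v 0 j; set c := w 0 j.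
(* The right side minus the left side is (a + b)^2 + (4a - c)^2 / 4 + (4b + c)^2 / 4. *)
have := sqr_ge0 (a + b); have := sqr_ge0 (4 * a - c); have := sqr_ge0 (4 * b + c).
nra.
Qed.

End euclidean.

(** * Differentiable, convex and smooth functions *)

Section gradient.
Context {R : realType} {d : nat}.
Implicit Types (f : 'rV[R]_d -> R) (x y v : 'rV[R]_d).

Lemma derive_gradient f x v :
  differentiable f x -> 'D_v f x = dotv (gradient f x) v.
Proof.
move=> df; rewrite deriveE// {1}(row_sum_delta v) linear_sum/=.
by apply: eq_bigr => j _; rewrite linearZ/= mxE deriveE// mulrC.
Qed.

(** Restricts [f] to a line so that the one-variable mean value theorem applies; the two difference
    quotients are the same function of the increment. *)
Lemma is_derive_line f x v (t : R) : differentiable f (x + t *: v) ->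
  is_derive t 1 (fun s : R => f (x + s *: v)) (dotv (gradient f (x + t *: v)) v).
Proof.
move=> df; rewrite -derive_gradient//.
have E : (fun h : R => h^-1 *: (((fun s : R => f (x + s *: v)) \o shift t) (h *: 1)
            - f (x + t *: v))) =
         (fun h : R => h^-1 *: ((f \o shift (x + t *: v)) (h *: v)
            - f (x + t *: v))).
  apply/funext => h /=; congr (_ *: (f _ - _)).
  by rewrite scalerDl [h *: 1]mulr1 addrCA.
have /(@diff_derivable _ _ _ _ _ v) := df.
rewrite /derivable => cv.
by split; rewrite /derivable /derive ?E.
Qed.

(** For 0 < h < 1, convexity bounds the difference quotient at [x] in direction [y - x] by
    [f y - f x]. The directional derivative is its limit as h tends to 0 from the right. *)
Lemma convex_ge_tangent f x y : convex_function setT f -> differentiable f x ->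
  f x + dotv (gradient f x) (y - x) <= f y.
Proof.
move=> cf df; rewrite -lerBrDl -derive_gradient//.
have /(@diff_derivable _ _ _ _ _ (y - x)) := df.
rewrite /derivable => cv.
have cvr := cvg_dnbhs_at_right cv.
have -> : 'D_(y - x) f x =
   lim ((fun h : R => h^-1 *: ((f \o shift x) (h *: (y - x)) - f x)) @ 0^'+).
  by apply/esym/cvg_lim.
apply: limr_le; first exact/cvgP/cvr.
near=> h.
have h0 : 0 < h by near: h; exact: nbhs_right_gt.
have h1 : h < 1 by near: h; exact: nbhs_right_lt.
have h01 : Itv.spec (@Itv.num_sem R) (Itv.Real `[0%Z, 1%Z]) h.
  by apply/andP; split; [exact: ger0_real (ltW h0)|rewrite /= in_itv/= !ltW].
have := cf (Itv.mk h01) y x; rewrite !inE => /(_ I I).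
rewrite convRE /= /conv/= => H.
rewrite /= -[leLHS]/(h^-1 * _) mulrC ler_pdivrMr//.
have -> : h *: (y - x) + x = h *: y + unstable.onem h *: x.
  by rewrite /unstable.onem scalerBl scale1r scalerBr -addrA (addrC x).
move: H; rewrite /unstable.onem.
lra.
Unshelve. all: by end_near. Qed.

(** Descent lemma. The mean value theorem is applied on [0, 1] to [h], which is [f] along the
    segment minus the linear and quadratic terms of the bound. Its derivative is nonpositive by
    Cauchy-Schwarz and the Lipschitz gradient. *)
Lemma smooth_le_quadratic f (L : R) x y : (forall z, differentiable f z) ->
  smooth L f ->
  f y <= f x + dotv (gradient f x) (y - x) + L / 2 * norm2 (y - x) ^+ 2.
Proof.
move=> df sf; set v := y - x; set c := dotv (gradient f x) v.
set q := norm2 v ^+ 2.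
pose h (t : R) : R := f (x + t *: v) - (c * t + L / 2 * q * t ^+ 2).
pose dh (t : R) : R := dotv (gradient f (x + t *: v)) v - (c + L * q * t).
have hd (t : R) : is_derive t 1 h (dh t).
  have ? := is_derive_line _ _ _ _ (df (x + t *: v)).
  rewrite /h /dh; apply: is_derive_eq.
  by rewrite -![_ *: 1]/(_ * 1) -[(_ * _) *: _]/(_ * _); field.
have hc : {within `[0, 1], continuous h}.
  apply: continuous_subspaceT => s.
  have [? _] := hd s.
  exact/differentiable_continuous/derivable1_diffP.
have [t /[!in_itv]/= /andP[t0 t1]] := MVT ltr01 (fun t _ => hd t) hc.
rewrite subr0 mulr1.
have -> : h 1 = f y - (c + L / 2 * q).
  by rewrite /h scale1r /v subrKC expr1n !mulr1.
have -> : h 0 = f x by rewrite /h scale0r addr0 expr0n/= !mulr0 addr0 subr0.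
suff : dh t <= 0 by lra.
have : dotv (gradient f (x + t *: v) - gradient f x) v <= L * t * q.
  apply: (le_trans (dotv_le_norm2 _ _)).
  apply: (@le_trans _ _ (L * norm2 (t *: v) * norm2 v)).
    apply: ler_wpM2r; first exact: norm2_ge0.
    by have := sf x (x + t *: v); rewrite addrAC subrr add0r.
  rewrite /q expr2 !mulrA; apply: ler_wpM2r; first exact: norm2_ge0.
  by rewrite -!mulrA norm2Z// ltW.
by rewrite dotvDl dotvNl /dh -/c; lra.
Qed.

(* A gradient step of length 1/L from [x] applied to [f - <grad f y, .>],
   which is minimal at [y]. *)
Lemma convex_smooth_bregman_ge f (L : R) x y : 0 < L ->
  (forall z, differentiable f z) -> convex_function setT f -> smooth L f ->
  (2 * L)^-1 * norm2 (gradient f x - gradient f y) ^+ 2 <=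
  f x - f y - dotv (gradient f y) (x - y).
Proof.
move=> L0 df cf sf; set u := gradient f x - gradient f y.
pose z := x - L^-1 *: u.
(* The value [f z] is bounded below by the tangent at [y] and above by the quadratic at [x];
   comparing the two bounds eliminates it. *)
have := convex_ge_tangent _ _ z cf (df y).
have := smooth_le_quadratic _ _ x z df sf.
have -> : z - x = - (L^-1 *: u) by rewrite /z addrAC subrr add0r.
have -> : z - y = (x - y) - L^-1 *: u by rewrite /z addrAC.
have -> : norm2 (- (L^-1 *: u)) ^+ 2 = L^-1 ^+ 2 * norm2 u ^+ 2.
  by rewrite norm2N norm2Z ?exprMn// invr_ge0 ltW.
have : dotv (gradient f x) u - dotv (gradient f y) u = norm2 u ^+ 2.
  by rewrite sqr_norm2 {3}/u dotvDl dotvNl.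
rewrite !dotvNr dotvDr !dotvNr !dotvZr => Hu.
set A := dotv (gradient f x) u in Hu *; set B := dotv (gradient f y) u in Hu *.
have -> : A = B + norm2 u ^+ 2 by lra.
have -> : L / 2 * (L^-1 ^+ 2 * norm2 u ^+ 2) = (2 * L)^-1 * norm2 u ^+ 2.
  by field; rewrite gt_eqF.
have -> : L^-1 * (B + norm2 u ^+ 2) = L^-1 * B + 2 * ((2 * L)^-1 * norm2 u ^+ 2).
  by field; rewrite gt_eqF.
lra.
Qed.

Lemma gradient_average n (f : 'I_n -> 'rV[R]_d -> R) x :
  (forall i, differentiable (f i) x) ->
  gradient (average f) x = n%:R^-1 *: \sum_(i < n) gradient (f i) x.
Proof.
move=> df; apply/rowP => j; rewrite !mxE summxE.
have di i : derivable (f i) x (delta_mx 0 j) by exact: diff_derivable.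
have -> : average f = n%:R^-1 \*: (\sum_(i < n) f i).
  by apply/funext => y; rewrite /average /= fct_sumE.
rewrite deriveZ; last exact: derivable_sum.
rewrite derive_sum//; congr (_ * _).
by apply: eq_bigr => i _; rewrite mxE.
Qed.

(** Triangle inequality. This makes the descent lemma available for F, whose gradient must be shown
    to vanish at the minimizer. *)
Lemma smooth_average n (f : 'I_n -> 'rV[R]_d -> R) (L : R) : (0 < n)%N ->
  (forall i y, differentiable (f i) y) -> (forall i, smooth L (f i)) ->
  smooth L (average f).
Proof.
move=> n0 df sf x y.
have nR : 0 < n%:R :> R by rewrite ltr0n.
rewrite !gradient_average// -scalerBr -sumrB norm2Z ?invr_ge0// mulrC ler_pdivrMr//.
apply: (@le_trans _ _ (\sum_(i < n) norm2 (gradient (f i) y - gradient (f i) x))).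
  elim/big_ind2: _ => [|u a v b ua vb|//].
    by rewrite /norm2 dotv0l sqrtr0.
  by apply: (le_trans (norm2D _ _)); exact: lerD.
apply: (@le_trans _ _ (\sum_(i < n) L * norm2 (y - x))).
  by apply: ler_sum => i _; exact: sf.
by rewrite sumr_const card_ord mulr_natr.
Qed.

(** A gradient step of length 1/L lowers [f] by at least |u|^2 / (2L), which minimality forbids
    unless u = 0. *)
Lemma gradient_minimizer f (L : R) x : 0 < L ->
  (forall z, differentiable f z) -> smooth L f ->
  minimizer_on setT f x -> gradient f x = 0.
Proof.
move=> L0 df sf [_ xmin]; set u := gradient f x.
pose z := x - L^-1 *: u.
have := smooth_le_quadratic _ _ x z df sf.
have -> : z - x = - (L^-1 *: u) by rewrite /z addrAC subrr add0r.
have := xmin z I.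
rewrite sqr_norm2 !(dotvNl, dotvNr, dotvZl, dotvZr) opprK -/u => H1 H2.
apply: dotvv_eq0; apply/eqP; rewrite eq_le dotvv_ge0 andbT.
rewrite -(@pmulr_rle0 _ (L^-1 / 2)) ?divr_gt0 ?invr_gt0//.
have : L / 2 * (L^-1 * (L^-1 * dotv u u)) = L^-1 / 2 * dotv u u.
  by field; rewrite gt_eqF.
lra.
Qed.

End gradient.


(** * Second moment of the gradient estimate under the optimal sampling law *)

Lemma sqr_sum_le {R : realType} (n : nat) (t : 'I_n -> R) :
  (\sum_(i < n) t i) ^+ 2 <= n%:R * \sum_(i < n) t i ^+ 2.
Proof.
(* Cauchy-Schwarz for [t] against the all-ones vector. *)
pose u : 'rV[R]_n := \row_i t i; pose v : 'rV[R]_n := \row_i 1.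
have -> : \sum_(i < n) t i = dotv u v.
  by apply: eq_bigr => i _; rewrite !mxE mulr1.
have -> : \sum_(i < n) t i ^+ 2 = norm2 u ^+ 2.
  by rewrite sqr_norm2; apply: eq_bigr => i _; rewrite !mxE expr2.
have -> : n%:R = norm2 v ^+ 2.
  rewrite sqr_norm2 -[n in n%:R]card_ord -sumr_const.
  by apply: eq_bigr => i _; rewrite !mxE mulr1.
rewrite -exprMn mulrC -ler_sqrt ?sqr_ge0// !sqrtr_sqr.
rewrite [leRHS]ger0_norm ?mulr_ge0 ?norm2_ge0//.
rewrite ler_norml dotv_le_norm2 andbT lerNl -dotvNl -[norm2 u]norm2N.
exact: dotv_le_norm2.
Qed.

Section sampling.
Context {R : realType} {d n : nat}.
Implicit Types (g u s : 'I_n -> 'rV[R]_d) (p : 'rV[R]_n) (eps : R).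

(* Compare [p] with the distribution [eps + (1 - n eps) |g_i| / sum_j |g_j|]. *)
Lemma minimal_sampling_objective_le g p eps : (0 < n)%N ->
  0 < eps <= 1 / (2 * n%:R) ->
  minimizer_on (simplex_lb eps) (sampling_objective g) p ->
  sampling_objective g p <=
  (1 + 2 * n%:R * eps) * (1 / n%:R ^+ 2 * (\sum_(i < n) norm2 (g i)) ^+ 2).
Proof.
move=> n0 /andP[e0 ele] [_ pmin].
have nR : 0 < n%:R :> R by rewrite ltr0n.
have ne : n%:R * eps <= 1 / 2.
  by move: ele; rewrite ler_pdivlMr ?mulr_gt0//; lra.
have ne0 : 0 < n%:R * eps by rewrite mulr_gt0.
set S := \sum_(i < n) norm2 (g i).
have S0 : 0 <= S by apply: sumr_ge0 => i _; exact: norm2_ge0.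
(* If S = 0 the comparison law cannot be normalized, but then every |g_i| is zero and so is the
   objective. *)
have [S_eq0|S_neq0] := eqVneq S 0.
  rewrite S_eq0 expr0n/= !mulr0 /sampling_objective big1 ?mulr0// => i _.
  have := psumr_eq0P (fun i _ => norm2_ge0 (g i)) S_eq0.
  by move=> /(_ i isT) ->; rewrite expr0n/= mulr0.
have Sp : 0 < S by rewrite lt_neqAle eq_sym S_neq0.
pose q : 'rV[R]_n := \row_i (eps + (1 - n%:R * eps) * (norm2 (g i) / S)).
have q_ge i : eps <= q 0 i.
  by rewrite mxE lerDl mulr_ge0 ?divr_ge0 ?norm2_ge0//; lra.
have qS : simplex_lb eps q.
  split=> //; split=> [i|]; first exact: le_trans (ltW e0) (q_ge i).
  under eq_bigr do rewrite mxE.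
  rewrite big_split/= sumr_const card_ord -mulr_sumr -mulr_suml -/S divff//.
  by rewrite mulr1 -mulr_natl; ring.
apply: (le_trans (pmin _ qS)).
rewrite /sampling_objective mulrCA ler_wpM2l//.
rewrite expr2 {2}/S mulrA mulr_sumr; apply: ler_sum => i _.
have qi0 : 0 < q 0 i by exact: lt_le_trans (q_ge i).
rewrite mul1r mulrC ler_pdivrMr// expr2 [leRHS]mulrAC ler_wpM2r ?norm2_ge0//.
have -> : (1 + 2 * n%:R * eps) * S * q 0 i =
    (1 + 2 * (n%:R * eps)) * eps * S
    + (1 + 2 * (n%:R * eps)) * (1 - n%:R * eps) * norm2 (g i).
  by rewrite mxE; field.
have := norm2_ge0 (g i); set N := norm2 _ => N0.
have : 0 <= (1 + 2 * (n%:R * eps)) * eps * S.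
  by rewrite !mulr_ge0// ?(ltW e0)//; lra.
set m := n%:R * eps in ne ne0 *.
(* The coefficient of N is (1 + 2m)(1 - m) = 1 + m (1 - 2m), at least 1 because m <= 1/2. *)
have : 0 <= (m * (1 - 2 * m)) * N by rewrite !mulr_ge0//; lra.
lra.
Qed.

(** Split u = (u - s) - (g - s) + g. The first two parts are bounded through 1/p_i <= 1/eps, the
    third through the optimality of [p] for [g]. It is applied with [u] and [s] the gradients at the
    iterate and at the minimizer. *)
Lemma sampling_objective_le g u s p eps : (0 < n)%N ->
  0 < eps <= 1 / (2 * n%:R) ->
  minimizer_on (simplex_lb eps) (sampling_objective g) p ->
  sampling_objective u p <=
    6 / (n%:R ^+ 2 * eps) * (\sum_(i < n) norm2 (u i - s i) ^+ 2
                             + \sum_(i < n) norm2 (g i - s i) ^+ 2)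
    + (1 + 2 * n%:R * eps) *
      (2 * (1 / n%:R ^+ 2 * (\sum_(i < n) norm2 (s i)) ^+ 2)
       + 6 / n%:R * \sum_(i < n) norm2 (g i - s i) ^+ 2).
Proof.
move=> n0 heps hp; have [[_ p_ge] _] := hp.
have gle := minimal_sampling_objective_le g p eps n0 heps hp.
case/andP: heps => e0 _.
have nR : 0 < n%:R :> R by rewrite ltr0n.
have p0 i : 0 < p 0 i by exact: lt_le_trans (p_ge i).
set D := \sum_(i < n) norm2 (u i - s i) ^+ 2.
set G := \sum_(i < n) norm2 (g i - s i) ^+ 2.
have n2 : 0 <= 1 / n%:R ^+ 2 :> R by rewrite divr_ge0// exprn_ge0// ltW.
have split_obj : sampling_objective u p <=
    6 / (n%:R ^+ 2 * eps) * (D + G) + 3 / 2 * sampling_objective g p.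
  have -> : 6 / (n%:R ^+ 2 * eps) * (D + G) + 3 / 2 * sampling_objective g p =
      1 / n%:R ^+ 2 * (\sum_(i < n) (6 / eps * (norm2 (u i - s i) ^+ 2
        + norm2 (g i - s i) ^+ 2) + 3 / 2 * (1 / p 0 i * norm2 (g i) ^+ 2))).
    rewrite big_split/= -!mulr_sumr big_split/= -/D -/G /sampling_objective.
    by field; rewrite !gt_eqF.
  apply: ler_wpM2l => //; apply: ler_sum => i _.
  have -> : u i = (u i - s i) - (g i - s i) + g i.
    by rewrite opprB addrA subrK subrK.
  apply: (le_trans (ler_wpM2l _ (sqr_norm2_three _ _ _))).
    by rewrite divr_ge0// ltW.
  rewrite (_ : u i - s i - (g i - s i) + g i - s i = u i - s i); last first.
    by rewrite opprB addrA subrK subrK.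
  have ip_le : (p 0 i)^-1 <= eps^-1 by rewrite lef_pV2 ?posrE.
  have := ler_wpM2r (addr_ge0 (sqr_ge0 (norm2 (u i - s i)))
    (sqr_ge0 (norm2 (g i - s i)))) ip_le.
  lra.
(* The weights come from 4/3 A^2 + 4 B^2 - (A + B)^2 = (A - 3B)^2 / 3; multiplied by 3/2 they become
   the constants 2 and 6 of the claim. *)
have sum_le : (\sum_(i < n) norm2 (g i)) ^+ 2 <=
    4 / 3 * (\sum_(i < n) norm2 (s i)) ^+ 2 + 4 * (n%:R * G).
  have := sqr_sum_le _ (fun i => norm2 (g i - s i)); rewrite -/G.
  set B := \sum_(i < n) norm2 (g i - s i); set A := \sum_(i < n) norm2 (s i).
  set C := \sum_(i < n) norm2 (g i) => BG.
  have C0 : 0 <= C by apply: sumr_ge0 => i _; exact: norm2_ge0.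
  have CAB : C <= A + B.
    rewrite -big_split/=; apply: ler_sum => i _.
    by rewrite -{1}(subrKC (s i) (g i)) norm2D.
  have : C ^+ 2 <= (A + B) ^+ 2 by rewrite ler_sqr// nnegrE// (le_trans C0).
  have := sqr_ge0 (A - 3 * B).
  lra.
apply: (le_trans split_obj); rewrite lerD2l.
have m0 : 0 <= 1 + 2 * n%:R * eps.
  by rewrite addr_ge0// !mulr_ge0// ltW.
apply: (@le_trans _ _ (3 / 2 * ((1 + 2 * n%:R * eps) * (1 / n%:R ^+ 2 *
    (4 / 3 * (\sum_(i < n) norm2 (s i)) ^+ 2 + 4 * (n%:R * G)))))).
  rewrite ler_pM2l ?divr_gt0//; apply: (le_trans gle).
  by apply: ler_wpM2l => //; exact: ler_wpM2l.
rewrite le_eqVlt; apply/orP; left; apply/eqP.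
by field; rewrite gt_eqF.
Qed.

End sampling.

(** * Contraction of the Lyapunov function in conditional mean *)

Section one_step.
Context {R : realType} {d n : nat}.

(** This update and the next one are functions of the state and of the outcome (i, c) of the draw,
    so that a conditional expectation becomes a finite sum over outcomes. *)
Definition srg_next_x (f : 'I_n -> 'rV[R]_d -> R) (alpha : R) (p : 'rV[R]_n)
    (x : 'rV[R]_d) (i : 'I_n) : 'rV[R]_d :=
  x - (alpha * (1 / (n%:R * p 0 i))) *: gradient (f i) x.

Definition srg_next_g (f : 'I_n -> 'rV[R]_d -> R) (g : 'I_n -> 'rV[R]_d)
    (x : 'rV[R]_d) (i : 'I_n) (c : bool) : 'I_n -> 'rV[R]_d :=
  fun j => if (j == i) && c then gradient (f j) x else g j.

(** The factor 1/(n p_i) makes the gradient estimate unbiased, which gives the inner product; its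
    second moment is the sampling objective of the current gradients. *)
Lemma mean_sqr_dist_next (f : 'I_n -> 'rV[R]_d -> R) (alpha : R)
    (p : 'rV[R]_n) (x xs : 'rV[R]_d) : (0 < n)%N -> (forall i, 0 < p 0 i) ->
  \sum_(i < n) p 0 i = 1 ->
  \sum_(i < n) p 0 i * norm2 (srg_next_x f alpha p x i - xs) ^+ 2 =
  norm2 (x - xs) ^+ 2
  - 2 * alpha * dotv (n%:R^-1 *: \sum_(i < n) gradient (f i) x) (x - xs)
  + alpha ^+ 2 * sampling_objective (fun i => gradient (f i) x) p.
Proof.
move=> n0 p0 p1; have nR : 0 < n%:R :> R by rewrite ltr0n.
have -> : norm2 (x - xs) ^+ 2 = \sum_(i < n) p 0 i * norm2 (x - xs) ^+ 2.
  by rewrite -mulr_suml p1 mul1r.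
rewrite dotvZl dotv_suml /sampling_objective !mulr_sumr -sumrN -!big_split/=.
apply: eq_bigr => i _; rewrite /srg_next_x [x - _ - xs]addrAC !sqr_norm2.
move: (x - xs) (gradient (f i) x) => v u.
rewrite !(dotvDl, dotvDr, dotvNl, dotvNr, dotvZl, dotvZr) (dotvC v u).
by field; rewrite !gt_eqF.
Qed.

Lemma sum_sqr_dist_next_g (f : 'I_n -> 'rV[R]_d -> R) (g : 'I_n -> 'rV[R]_d)
    (x xs : 'rV[R]_d) (i : 'I_n) (c : bool) :
  \sum_(j < n) norm2 (srg_next_g f g x i c j - gradient (f j) xs) ^+ 2 =
  \sum_(j < n) norm2 (g j - gradient (f j) xs) ^+ 2 +
  (if c then norm2 (gradient (f i) x - gradient (f i) xs) ^+ 2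
             - norm2 (g i - gradient (f i) xs) ^+ 2 else 0).
Proof.
rewrite (bigD1 i)//= [X in _ = X + _](bigD1 i)//= /srg_next_g eqxx/=.
rewrite (eq_bigr (fun j => norm2 (g j - gradient (f j) xs) ^+ 2)); last first.
  by move=> j /negbTE ->.
by case: c; ring.
Qed.

Lemma lyapunov_ge0 (f : 'I_n -> 'rV[R]_d -> R) (L alpha eps a : R)
    (xs : 'rV[R]_d) g x : 0 <= L -> 0 <= alpha -> 0 <= eps -> 0 <= a ->
  0 <= lyapunov f L alpha eps a xs g x.
Proof.
move=> L0 al0 e0 a0; rewrite addr_ge0 ?sqr_ge0//.
rewrite !mulr_ge0 ?invr_ge0 ?mulr_ge0//.
by apply: sumr_ge0 => i _; rewrite sqr_ge0.
Qed.

(** The left side is the conditional mean of the next Lyapunov value: outcome (i, true) has weight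
    [eps] and (i, false) has weight p_i - eps. *)
Lemma lyapunov_mean_next_le (f : 'I_n -> 'rV[R]_d -> R) (mu L eps alpha a : R)
    (xs x : 'rV[R]_d) (g : 'I_n -> 'rV[R]_d) (p : 'rV[R]_n) :
  let zeta := Num.min (L / n%:R) mu in
  (0 < n)%N -> 0 < L ->
  strongly_convex mu (average f) ->
  (forall i y, differentiable (f i) y) ->
  (forall i, convex_function setT (f i)) ->
  (forall i, smooth L (f i)) ->
  gradient (average f) xs = 0 ->
  0 < eps <= 1 / (2 * n%:R) ->
  0 < alpha <= n%:R * eps / (20 * L) ->
  12 / 19 <= a <= 7 / 10 ->
  minimizer_on (simplex_lb eps) (sampling_objective g) p ->
  \sum_(i < n) (eps * lyapunov f L alpha eps a xs (srg_next_g f g x i true)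
                        (srg_next_x f alpha p x i)
              + (p 0 i - eps) * lyapunov f L alpha eps a xs
                  (srg_next_g f g x i false) (srg_next_x f alpha p x i)) <=
  (1 - alpha * zeta) * lyapunov f L alpha eps a xs g x
  + (1 + 2 * n%:R * eps) * (2 * alpha ^+ 2 * sigma2_star f xs).
Proof.
move=> zeta n0 L0 sc df cf sf gF0 heps /andP[al0 alle] /andP[a_ge a_le] hp.
have a0 : 0 <= a by exact: le_trans a_ge.
have [[[_ p1] p_ge] _] := hp.
have nR : 0 < n%:R :> R by rewrite ltr0n.
have M_le := sampling_objective_le g (fun i => gradient (f i) x)
  (fun i => gradient (f i) xs) p eps n0 heps hp.
case/andP: (heps) => e0 ele.
have ne : n%:R * eps <= 1 / 2.
  by move: ele; rewrite ler_pdivlMr ?mulr_gt0//; lra.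
have ne0 : 0 < n%:R * eps by rewrite mulr_gt0.
have p0 i : 0 < p 0 i by exact: lt_le_trans (p_ge i).
have x_next := mean_sqr_dist_next f alpha p x xs n0 p0 p1.
set D := \sum_(i < n) norm2 (gradient (f i) x - gradient (f i) xs) ^+ 2 in M_le.
set G := \sum_(i < n) norm2 (g i - gradient (f i) xs) ^+ 2 in M_le.
set M := sampling_objective _ _ in M_le x_next.
set ip := dotv _ _ in x_next.
set r := norm2 (x - xs) ^+ 2 in x_next.
have D0 : 0 <= D by apply: sumr_ge0 => i _; exact: sqr_ge0.
have G0 : 0 <= G by apply: sumr_ge0 => i _; exact: sqr_ge0.
have r0 : 0 <= r by exact: sqr_ge0.
pose c := alpha / (n%:R * eps) * (a / L).
have -> : \sum_(i < n) (eps * lyapunov f L alpha eps a xs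
        (srg_next_g f g x i true) (srg_next_x f alpha p x i)
      + (p 0 i - eps) * lyapunov f L alpha eps a xs
        (srg_next_g f g x i false) (srg_next_x f alpha p x i)) =
    c * (G + eps * (D - G)) + (r - 2 * alpha * ip + alpha ^+ 2 * M).
  (* The old sum G occurs with total weight p_i, while the correction at index i occurs only when c
     is true, hence with weight [eps]. *)
  have -> : c * (G + eps * (D - G)) =
      \sum_(i < n) p 0 i * (c * G) + \sum_(i < n) c * (eps *
        (norm2 (gradient (f i) x - gradient (f i) xs) ^+ 2
         - norm2 (g i - gradient (f i) xs) ^+ 2)).
    by rewrite -mulr_suml p1 mul1r -!mulr_sumr sumrB mulrDr.
  rewrite -x_next -!big_split/=.
  apply: eq_bigr => i _; rewrite /lyapunov !sum_sqr_dist_next_g -/G -/c.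
  by ring.
(* Strong convexity at [x] towards [xs], and cocoercivity of each gradient. *)
have ip_ge : (2 * L * n%:R)^-1 * D + mu / 2 * r <= ip.
  have := sc x xs; rewrite gradient_average// -[xs - x]opprB dotvNr -/ip.
  rewrite norm2N -/r => H.
  suff : (2 * L * n%:R)^-1 * D <= average f x - average f xs by lra.
  have -> : average f x - average f xs = n%:R^-1 *
      \sum_(i < n) (f i x - f i xs - dotv (gradient (f i) xs) (x - xs)).
    rewrite !sumrB -dotv_suml !mulrBr -dotvZl -gradient_average//.
    by rewrite gF0 dotv0l subr0.
  rewrite mulrC invfM mulrA mulrC ler_pM2l ?invr_gt0//.
  rewrite mulrC mulr_sumr; apply: ler_sum => i _.
  exact: convex_smooth_bregman_ge.
rewrite /lyapunov -/c -/G -/r -[sigma2_star f xs]/(1 / n%:R ^+ 2 * _).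
set sg := 1 / n%:R ^+ 2 * (\sum_(i < n) norm2 (gradient (f i) xs)) ^+ 2 in M_le *.
(* Common unit for the coefficients of D and G; in particular c eps = a w. *)
pose w := alpha / (n%:R * L).
have w0 : 0 < w by rewrite divr_gt0 ?mulr_gt0.
have al_ne : alpha / (n%:R * eps) <= (20 * L)^-1.
  by rewrite ler_pdivrMr// mulrC.
have ceps : c * eps = a * w.
  by rewrite /c /w; field; rewrite !gt_eqF.
have K_le : alpha ^+ 2 * (6 / (n%:R ^+ 2 * eps)) <= 3 / 10 * w.
  have -> : alpha ^+ 2 * (6 / (n%:R ^+ 2 * eps)) =
      6 * (alpha / n%:R) * (alpha / (n%:R * eps)).
    by field; rewrite !gt_eqF.
  have -> : 3 / 10 * w = 6 * (alpha / n%:R) * (20 * L)^-1.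
    by rewrite /w; field; rewrite !gt_eqF.
  by rewrite ler_wpM2l// mulr_ge0// divr_ge0// ltW.
(* The bound n eps <= 1/2 gives both 1 + 2 n eps <= 2 and 2 n eps <= 1, hence alpha (1 + 2 n eps) <=
   1/(20 L). *)
have J_le : alpha ^+ 2 * ((1 + 2 * n%:R * eps) * (6 / n%:R)) <= 3 / 10 * w.
  have -> : 3 / 10 * w = 6 * (alpha / n%:R) * (20 * L)^-1.
    by rewrite /w; field; rewrite !gt_eqF.
  have -> : alpha ^+ 2 * ((1 + 2 * n%:R * eps) * (6 / n%:R)) =
      6 * (alpha / n%:R) * (alpha * (1 + 2 * (n%:R * eps))).
    by field; rewrite !gt_eqF.
  rewrite ler_wpM2l ?mulr_ge0 ?invr_ge0 ?(ltW al0)//.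
  apply: (@le_trans _ _ (n%:R * eps / (20 * L) * 2)).
    by rewrite ler_pM ?(ltW al0)//; lra.
  rewrite mulrAC -[leRHS]mul1r ler_wpM2r// ?invr_ge0 ?mulr_ge0 ?(ltW L0)//.
  lra.
have z1 : zeta <= L / n%:R by rewrite ge_min lexx.
have z2 : zeta <= mu by rewrite ge_min lexx orbT.
have c0 : 0 <= c by rewrite !mulr_ge0 ?invr_ge0 ?(ltW al0) ?(ltW L0) ?(ltW ne0)//.
(* Here zeta <= L/n enters: alpha zeta <= eps/20, and c eps = a w. *)
have cz : c * (alpha * zeta) <= 1 / 20 * (a * w).
  rewrite -ceps [leRHS]mulrCA ler_wpM2l//.
  apply: (@le_trans _ _ (n%:R * eps / (20 * L) * (L / n%:R))).
    apply: (@le_trans _ _ (alpha * (L / n%:R))); first by rewrite ler_pM2l.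
    by rewrite ler_wpM2r// divr_ge0// ltW.
  rewrite le_eqVlt; apply/orP; left; apply/eqP.
  by field; rewrite !gt_eqF.
have ip_al : w * D + alpha * mu * r <= 2 * alpha * ip.
  have -> : w * D + alpha * mu * r =
      2 * alpha * ((2 * L * n%:R)^-1 * D + mu / 2 * r).
    by rewrite /w; field; rewrite !gt_eqF.
  by rewrite ler_pM2l// mulr_gt0.
have M_al : alpha ^+ 2 * M <= 3 / 10 * w * (D + G) + 3 / 10 * w * G
    + (1 + 2 * n%:R * eps) * (2 * alpha ^+ 2 * sg).
  have al2 : 0 <= alpha ^+ 2 by exact: sqr_ge0.
  apply: (le_trans (ler_wpM2l al2 M_le)).
  have := ler_wpM2r (addr_ge0 D0 G0) K_le.
  have := ler_wpM2r G0 J_le.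
  lra.
have cz_G := ler_wpM2r G0 cz.
have z_r : alpha * zeta * r <= alpha * mu * r.
  by rewrite ler_wpM2r// ler_pM2l.
have wD : 0 <= w * D by rewrite mulr_ge0// ltW.
have wG : 0 <= w * G by rewrite mulr_ge0// ltW.
have -> : c * (G + eps * (D - G)) = c * G + c * eps * (D - G) by ring.
(* In units of w, the terms in D cancel if a + 3/10 <= 1, and those in G if 3/5 + a/20 <= a. This is
   the range 12/19 <= a <= 7/10. *)
have a_D : a * (w * D) <= 7 / 10 * (w * D) by rewrite ler_wpM2r.
have a_G : 12 / 19 * (w * G) <= a * (w * G) by rewrite ler_wpM2r.
rewrite ceps.
clear -cz_G z_r M_al ip_al a_D a_G.
lra.
Qed.

End one_step.


(** * Expectations along a run of the algorithm *)

Lemma expectation_finite {R : realType} {disp : measure_display}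
    {T : measurableType disp} (P : probability T R) {I : finType} (Z : T -> I)
    (phi : I -> R) :
  (forall i, measurable [set w | Z w = i]) -> (forall i, 0 <= phi i) ->
  ('E_P[fun w => phi (Z w)])%E =
  (\sum_i phi i * fine (P [set w | Z w = i]))%:E.
Proof.
move=> mZ phi0; rewrite unlock.
(* The composite is a finite sum of constants times indicators; nonnegativity allows integrating it
   term by term. *)
transitivity (\int[P]_w (\sum_(i <- index_enum I)
    (phi i)%:E * (\1_[set w | Z w = i] w)%:E))%E.
  apply: eq_integral => w _.
  rewrite (bigD1_seq (Z w)) ?mem_index_enum ?index_enum_uniq//=.
  rewrite big1 => [|i /eqP Zwi]; last first.
    by rewrite indicE memNset ?mule0//= => Zw; apply: Zwi.
  by rewrite indicE mem_set//= mule1 adde0.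
rewrite ge0_integral_sum//; last 2 first.
- move=> i; apply: measurable_funeM.
  exact/measurable_EFinP/measurable_indic.
- by move=> i w _; rewrite mule_ge0 ?lee_fin.
rewrite -sumEFin; apply: eq_bigr => i _.
rewrite ge0_integralZl_EFin//; last exact/measurable_EFinP/measurable_indic.
by rewrite integral_indic// setIT EFinM fineK// fin_num_measure.
Qed.

Section srg_process.
Context {disp : measure_display} {T : measurableType disp} {R : realType}
  {P : probability T R} {d n : nat}.
Context (f : 'I_n -> 'rV[R]_d -> R) (alpha eps : R)
  (x0 : 'rV[R]_d) (g0 : 'I_n -> 'rV[R]_d)
  (x : nat -> T -> 'rV[R]_d) (g : nat -> T -> 'I_n -> 'rV[R]_d)
  (p : nat -> T -> 'rV[R]_n) (idx : nat -> T -> 'I_n) (b : nat -> T -> bool).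

Lemma historyS k w :
  history idx b k.+1 w = rcons (history idx b k w) (idx k w, b k w).
Proof. exact: mkseqS. Qed.

Let Pr (A : set T) : R := fine (P A).

Let atom k (h : seq ('I_n * bool)) : set T := [set w | history idx b k w = h].

(** These are exactly the events that the history at time k+1 is [h] followed by (i, c). *)
Let branch k h i c : set T :=
  atom k h `&` [set w | idx k w = i] `&` [set w | b k w = c].

Context (srg : SRG_run P f (fun _ => alpha) (fun _ => eps) x0 g0 x g p idx b).

(** All randomness enters through [idx] and [b], so the state is constant on each atom of the
    history. *)
Lemma srg_state_history k w w' :
  history idx b k w = history idx b k w' -> x k w = x k w' /\ g k w = g k w'.
Proof.
elim: k w w' => [|k IH] w w' hw.
  split; first by rewrite !(SRG_x0 srg).
  by apply/funext => i; rewrite !(SRG_g0 srg).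
move: hw; rewrite !historyS => /rcons_inj[/[dup] /IH[xE gE] /(SRG_p_history srg) pE iE bE].
split; first by rewrite !(SRG_x_step srg) xE pE iE.
by apply/funext => j; rewrite !(SRG_g_step srg) xE gE iE bE.
Qed.

Lemma measurable_b k c : measurable [set w | b k w = c].
Proof.
case: c; first exact: (SRG_b_measurable srg).
rewrite (_ : [set _ | _] = ~` [set w | b k w = true]).
  exact/measurableC/(SRG_b_measurable srg).
by apply/seteqP; split => w /=; case: (b k w).
Qed.

Lemma measurable_history k h : measurable [set w | history idx b k w = h].
Proof.
elim: k h => [|k IH] h.
  case: h => [|s h].
    by rewrite (_ : [set _ | _] = setT)//; apply/seteqP; split.
  by rewrite (_ : [set _ | _] = set0)//; apply/seteqP; split.
under eq_set do rewrite historyS.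
case/lastP: h => [|h [i c]].
  rewrite (_ : [set _ | _] = set0)//; apply/seteqP; split => // w /=.
  by case: (history idx b k w).
rewrite (_ : [set _ | _] = branch k h i c).
  apply: measurableI (measurable_b _ _).
  exact: measurableI (IH h) (SRG_idx_measurable srg _ _).
apply/seteqP; split => w /=.
  by move=> /rcons_inj[? ? ?].
by case=> -[/= -> ->] ->.
Qed.

Lemma measurable_branch k h i c : measurable (branch k h i c).
Proof.
apply: measurableI (measurable_b _ _).
exact: measurableI (measurable_history _ _) (SRG_idx_measurable srg _ _).
Qed.

Lemma Pr_eq0 A B : measurable A -> measurable B -> A `<=` B -> Pr B = 0 -> Pr A = 0.
Proof.
move=> mA mB AB B0; apply/eqP; rewrite eq_le fine_ge0 ?measure_ge0// andbT -B0.
by rewrite fine_le ?fin_num_measure// le_measure ?inE.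
Qed.

Lemma Pr_neq0 A : measurable A -> (P A != 0%E) = (Pr A != 0).
Proof.
by move=> mA; rewrite -[P A]fineK ?fin_num_measure.
Qed.

(** Multiplying conditional laws, p_i cancels in p_i (eps / p_i) = eps; the false branch is the
    remainder of the event that [i] is drawn. *)
Lemma Pr_branch k w i c : 0 < eps -> Pr (atom k (history idx b k w)) != 0 ->
  Pr (branch k (history idx b k w) i c) =
  (if c then eps else p k w 0 i - eps) * Pr (atom k (history idx b k w)).
Proof.
move=> e0 H0; set H := atom k (history idx b k w).
have mH : measurable H by exact: measurable_history.
have mi : measurable [set w | idx k w = i] by exact: (SRG_idx_measurable srg).
have [[_ p_ge] _] := SRG_p_min srg k w.
have p0 : 0 < p k w 0 i by exact: lt_le_trans (p_ge i).
have Hi : Pr (H `&` [set w | idx k w = i]) = p k w 0 i * Pr H.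
  have PH0 : P H != 0%E by rewrite Pr_neq0.
  by rewrite -(SRG_idx_law srg i PH0) /cond_prob setIC divfK.
have Hit : Pr (branch k (history idx b k w) i true) = eps * Pr H.
  have Hi0 : Pr (H `&` [set w | idx k w = i]) != 0.
    by rewrite Hi mulf_neq0// gt_eqF.
  (* The law of [b] is stated at a sample point where [i] was drawn, so one is picked in this event
     of positive probability; p_k is the same there. *)
  have [w' [hw' iw']] : (H `&` [set w | idx k w = i]) !=set0.
    apply/set0P; apply: contra_neq Hi0 => ->.
    by rewrite /Pr measure0.
  have Hw' : [set v | history idx b k v = history idx b k w' /\
                      idx k v = idx k w'] = H `&` [set w | idx k w = i].
    by rewrite hw' iw'.
  have PHi0 : P (H `&` [set w | idx k w = i]) != 0%E.
    by rewrite Pr_neq0//; exact: measurableI.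
  have := SRG_b_law srg (k := k) (w := w'); rewrite Hw' => /(_ PHi0).
  rewrite (SRG_p_history srg hw') iw' /cond_prob => /(canRL (divfK Hi0)).
  rewrite setIC -[LHS]/(Pr (branch k _ i true)) => ->.
  rewrite -/(Pr _).
  by rewrite Hi mulrA divfK// gt_eqF.
case: c => //.
have : Pr (H `&` [set w | idx k w = i]) =
    Pr (branch k (history idx b k w) i true) +
    Pr (branch k (history idx b k w) i false).
  rewrite /Pr -fineD ?fin_num_measure//; try exact: measurable_branch.
  rewrite -measureU; [|exact: measurable_branch..|].
    rewrite -setIUr (_ : _ `|` _ = setT) ?setIT//; apply/seteqP; split => // v _.
    by rewrite /=; case: (b k v); [left|right].
  by apply/seteqP; split => // v [[_ /= bt] [_ /=]]; rewrite bt.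
by rewrite Hit Hi; lra.
Qed.

(* In the hypothesis, [eps] and [p_i - eps] are the conditional probabilities of
   [(idx, b) = (i, true)] and [(i, false)] given the history. *)
Lemma srg_expectation_step (Phi : ('I_n -> 'rV[R]_d) -> 'rV[R]_d -> R)
    (q C : R) k : 0 < eps ->
  (forall g x, 0 <= Phi g x) ->
  (forall w, \sum_(i < n)
     (eps * Phi (srg_next_g f (g k w) (x k w) i true)
                (srg_next_x f alpha (p k w) (x k w) i)
      + (p k w 0 i - eps) * Phi (srg_next_g f (g k w) (x k w) i false)
                (srg_next_x f alpha (p k w) (x k w) i))
   <= q * Phi (g k w) (x k w) + C) ->
  exists e : R, ('E_P[fun w => Phi (g k w) (x k w)])%E = e%:E /\
    ('E_P[fun w => Phi (g k.+1 w) (x k.+1 w)] <= (q * e + C)%:E)%E.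
Proof.
move=> e0 Phi0 step.
have [w0 _] : [set: T] !=set0.
  apply/set0P/eqP => T0; have := @probability_setT _ _ _ P.
  by rewrite T0 measure0 => /eqP; rewrite eq_sym onee_eq0.
(* The history as a tuple of fixed length lives in a finite type, so expectations become finite
   sums. *)
pose Z w : k.-tuple ('I_n * bool) := [tuple of mkseq (fun t => (idx t w, b t w)) k].
have ZE w h : Z w = h <-> history idx b k w = h.
  by split=> [<-//|hw]; apply: val_inj.
(* A sample point for every history that occurs; [w0] is the default for those that never do. *)
have [rep repP] : exists rep : k.-tuple ('I_n * bool) -> T,
    forall w, history idx b k (rep (Z w)) = history idx b k w.
  have /choice[rep repP] : forall h : k.-tuple ('I_n * bool), exists v,
      forall w, Z w = h -> history idx b k v = history idx b k w.
    move=> h; have [[w hw]|no] := pselect (exists w, Z w = h).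
      by exists w => v vh; apply: (congr1 val (etrans hw (esym vh))).
    by exists w0 => w wh; case: no; exists w.
  by exists rep => w; apply: repP.
have atomE h : [set w | Z w = h] = atom k h.
  by apply/seteqP; split => w /ZE.
have mZ h : measurable [set w | Z w = h].
  by rewrite atomE; exact: measurable_history.
exists (\sum_h Phi (g k (rep h)) (x k (rep h)) * Pr (atom k h)); split.
  under eq_fun => w.
    have [<- <-] := srg_state_history k (rep (Z w)) w (repP w).
    over.
  rewrite (expectation_finite P Z (fun h => Phi (g k (rep h)) (x k (rep h))))//.
  by under eq_bigr do rewrite atomE.
pose Z' w := (Z w, (idx k w, b k w)).
pose psi (z : k.-tuple ('I_n * bool) * ('I_n * bool)) :=
  Phi (srg_next_g f (g k (rep z.1)) (x k (rep z.1)) z.2.1 z.2.2)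
      (srg_next_x f alpha (p k (rep z.1)) (x k (rep z.1)) z.2.1).
have branchE h s : [set w | Z' w = (h, s)] = branch k h s.1 s.2.
  case: s => i c; apply/seteqP; split => w /=.
    by case=> /ZE hw iw bw.
  by case=> -[/= /ZE hw iw] bw; rewrite /Z' hw iw bw.
have -> : (fun w => Phi (g k.+1 w) (x k.+1 w)) = psi \o Z'.
  apply/funext => w; rewrite /psi /=.
  have [-> ->] := srg_state_history k (rep (Z w)) w (repP w).
  rewrite (SRG_p_history srg (repP w)) (SRG_x_step srg).
  by congr Phi; apply/funext => j; rewrite (SRG_g_step srg).
have mZ' z : measurable [set w | Z' w = z].
  by case: z => h s; rewrite branchE; exact: measurable_branch.
rewrite (expectation_finite P Z' psi mZ' (fun z => Phi0 _ _)).
have -> : \sum_z psi z * fine (P [set w | Z' w = z]) =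
    \sum_(h : k.-tuple ('I_n * bool)) \sum_s psi (h, s) * Pr (branch k h s.1 s.2).
  by rewrite pair_bigA; apply: eq_bigr => -[h s] _; rewrite branchE.
rewrite lee_fin.
(* The atoms have total mass 1, read off from the expectation of the constant 1. The claim can then
   be checked atom by atom. *)
have -> : C = \sum_(h : k.-tuple ('I_n * bool)) C * Pr (atom k h).
  rewrite -mulr_sumr -[LHS]mulr1; congr (_ * _).
  have := expectation_finite P Z (fun=> 1) mZ (fun=> ler01).
  rewrite -[fun=> 1]/(cst 1) expectation_cst => -[->].
  by apply: eq_bigr => h _; rewrite mul1r atomE.
rewrite mulr_sumr -big_split/=; apply: ler_sum => h _.
(* The conditional laws say nothing on a null atom, but both sides vanish there. *)
have [Ph0|Ph0] := eqVneq (Pr (atom k h)) 0.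
  rewrite Ph0 !mulr0 addr0 big1// => s _.
  rewrite (@Pr_eq0 _ (atom k h)) ?mulr0//.
  - exact: measurable_branch.
  - exact: measurable_history.
  - by move=> w [[]].
have [w hw] : atom k h !=set0.
  by apply/set0P; apply: contra_neq Ph0 => ->; rewrite /Pr measure0.
have rh : history idx b k (rep h) = h.
  by rewrite -hw -(repP w); congr (history idx b k (rep _)); apply/esym/ZE.
rewrite mulrA -mulrDl; apply: le_trans (ler_wpM2r _ (step (rep h))); last first.
  by rewrite fine_ge0// measure_ge0.
have -> : \sum_s psi (h, s) * Pr (branch k h s.1 s.2) =
    \sum_i \sum_c psi (h, (i, c)) * Pr (branch k h i c).
  by rewrite pair_bigA; apply: eq_bigr => -[i c].
rewrite mulr_suml le_eqVlt; apply/orP; left; apply/eqP; apply: eq_bigr => i _.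
have Pb c := Pr_branch k (rep h) i c e0; rewrite rh in Pb.
rewrite big_bool/= !Pb//.
by rewrite /psi/=; ring.
Qed.

End srg_process.

(** * The geometric recursion in k *)

Theorem corollary1 (R : realType) (d n : nat)
    (f : 'I_n -> 'rV[R]_d -> R) (mu L : R) (xs : 'rV[R]_d)
    (disp : measure_display) (T : measurableType disp) (P : probability T R)
    (eps alpha : R) (x0 : 'rV[R]_d) (g0 : 'I_n -> 'rV[R]_d)
    (x : nat -> T -> 'rV[R]_d) (g : nat -> T -> 'I_n -> 'rV[R]_d)
    (p : nat -> T -> 'rV[R]_n)
    (idx : nat -> T -> 'I_n) (b : nat -> T -> bool)
    (n_gt0 : (0 < n)%N) (mu_gt0 : 0 < mu) (L_gt0 : 0 < L)
    (F_diff : forall y, differentiable (average f) y)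
    (F_sc : strongly_convex mu (average f))
    (f_diff : forall i y, differentiable (f i) y)
    (f_convex : forall i, convex_function setT (f i))
    (f_smooth : forall i, smooth L (f i))
    (xs_min : unique (minimizer_on setT (average f)) xs)
    (eps_bounds : 0 < eps <= 1 / (2 * n%:R))
    (alpha_bounds : 0 < alpha <= n%:R * eps / (20 * L))
    (srg : SRG_run P f (fun _ => alpha) (fun _ => eps) x0 g0 x g p idx b)
    (k : nat) :
  let a : R := 673 / 1000 in
  let zeta : R := Num.min (L / n%:R) mu in
  ('E_P[fun w => lyapunov f L alpha eps a xs (g k w) (x k w)] <=
   ((1 - alpha * zeta) ^+ k * lyapunov f L alpha eps a xs g0 x0
    + (1 + 2 * n%:R * eps) * (2 * alpha * sigma2_star f xs / zeta))%:E)%E.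
Proof.
cbv zeta; set zeta := Num.min _ _; set a : R := 673 / 1000.
have /andP[al0 alle] := alpha_bounds.
have /andP[e0 ele] := eps_bounds.
have nR : 0 < n%:R :> R by rewrite ltr0n.
have a_bounds : 12 / 19 <= a <= 7 / 10 by apply/andP; split; rewrite /a; lra.
have gF0 : gradient (average f) xs = 0.
  apply: (gradient_minimizer (average f) L) => //; last by case: xs_min.
  exact: smooth_average.
have zeta0 : 0 < zeta by rewrite lt_min mu_gt0 divr_gt0.
have a0 : 0 <= a by case/andP: a_bounds => + _; apply: le_trans; lra.
clearbody a.
have Phi0 g' x' : 0 <= lyapunov f L alpha eps a xs g' x'.
  by rewrite lyapunov_ge0// ltW.
(* In fact alpha zeta <= eps/20. The factor 1 - alpha zeta is therefore nonnegative and may multiply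
   the induction hypothesis. *)
have az1 : alpha * zeta <= 1.
  apply: (@le_trans _ _ (n%:R * eps / (20 * L) * (L / n%:R))).
    by rewrite ler_pM ?(ltW al0) ?(ltW zeta0)// ge_min lexx.
  have -> : n%:R * eps / (20 * L) * (L / n%:R) = eps / 20.
    by field; rewrite !gt_eqF.
  have : eps <= 1.
    apply: (le_trans ele); rewrite ler_pdivrMr ?mulr_gt0// mul1r.
    have : 1 <= n%:R :> R by rewrite ler1n.
    lra.
  lra.
have s0 : 0 <= sigma2_star f xs by rewrite mulr_ge0 ?sqr_ge0.
elim: k => [|k IH].
  have -> : (fun w => lyapunov f L alpha eps a xs (g 0%N w) (x 0%N w)) =
      cst (lyapunov f L alpha eps a xs g0 x0).
    apply/funext => w; rewrite (SRG_x0 srg).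
    by congr lyapunov; apply/funext => i; rewrite (SRG_g0 srg).
  rewrite expectation_cst lee_fin expr0 mul1r lerDl.
  have al_s : 0 <= 2 * alpha * sigma2_star f xs.
    exact: mulr_ge0 (mulr_ge0 (ler0n _ 2) (ltW al0)) s0.
  apply: mulr_ge0 (divr_ge0 al_s (ltW zeta0)).
  by rewrite addr_ge0// !mulr_ge0// ltW.
have step w := lyapunov_mean_next_le f mu L eps alpha a xs (x k w) (g k w)
  (p k w) n_gt0 L_gt0 F_sc f_diff f_convex f_smooth gF0 eps_bounds
  alpha_bounds a_bounds (SRG_p_min srg k w).
have [e [Ek Ek1]] := srg_expectation_step f alpha eps x0 g0 x g p idx b srg
  (lyapunov f L alpha eps a xs) _ _ k e0 Phi0 step.
apply: (le_trans Ek1); rewrite lee_fin -/zeta.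
move: IH; rewrite Ek lee_fin => IH.
have az : 0 <= 1 - alpha * zeta by rewrite subr_ge0.
(* The residual is the fixed point of the affine recursion t -> (1 - alpha zeta) t + (1 + 2 n eps) 2
   alpha^2 sigma_star^2, which replaces an explicit geometric sum. *)
have -> : (1 + 2 * n%:R * eps) * (2 * alpha * sigma2_star f xs / zeta) =
    (1 - alpha * zeta) * ((1 + 2 * n%:R * eps) *
      (2 * alpha * sigma2_star f xs / zeta))
    + (1 + 2 * n%:R * eps) * (2 * alpha ^+ 2 * sigma2_star f xs).
  by field; rewrite gt_eqF.
rewrite [leRHS]addrA lerD2r [_ ^+ k.+1]exprS -[X in _ <= X + _]mulrA -mulrDr.
exact: ler_wpM2l.
Qed.
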